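(* Let $X$ be a Hausdorff space, let $I$ be an interval in $\mathbb{R}$, and let $\mathcal{X}=\mathcal{C}_{\mathrm{loc}}(I,X)$. Let $\{\rho_\varepsilon\}_{\varepsilon\in\mathcal{E}}$ be a family (net, with $\mathcal{E}$ a directed set) such that each $\rho_\varepsilon$ is a $\mathcal{U}_\varepsilon$-trajectory statistical solution, for subsets $\mathcal{U}_\varepsilon\subset\mathcal{X}$, carried by Borel subsets $\mathcal{V}_\varepsilon\subset\mathcal{X}$. Let $\mathcal{U}\subset\mathcal{X}$ and suppose there is a sequence $\{\mathcal{K}_n\}_{n\in\mathbb{N}}$ of compact sets in $\mathcal{X}$ and a sequence of real numbers $\delta_n\to 0$ such that, for all $n\in\mathbb{N}$, (A1) $\rho_\varepsilon(\mathcal{X}\setminus\mathcal{K}_n)<\delta_n$ for all $\varepsilon\in\mathcal{E}$; (A2) $\limsup_{\varepsilon\in\mathcal{E}}(\mathcal{V}_\varepsilon\cap\mathcal{K}_n)\subset\mathcal{U}$, where $\limsup$ is the topological superior limit in $\mathcal{X}$. Then there exists a $\mathcal{U}$-trajectory statistical solution $\rho$ which is a weak-star semicontinuity limit of a subnet of $\{\rho_\varepsilon\}_{\varepsilon\in\mathcal{E}}$. Moreover, if the interval $I$ is closed and bounded on the left with left endpoint $t_0$ and $\Pi_{t_0}\rho_\varepsilon\stackrel{wsc*}{\rightharpoonup}\mu_0$ for some tight Borel probability measure $\mu_0$ on $X$, then $\Pi_{t_0}\rho=\mu_0$.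
   Context: $\mathcal{C}_{\mathrm{loc}}(I,X)$ is the space of continuous functions $u:I\to X$ endowed with the compact-open topology (uniform convergence on compact subsets of $I$). For $t\in I$, $\Pi_t:\mathcal{X}\to X$ is $\Pi_t u=u(t)$, and $\Pi_t\rho$ denotes the push-forward measure $\Pi_t\rho(E)=\rho(\Pi_t^{-1}(E))$. A finite Borel measure $\mu$ on a Hausdorff space $Y$ is tight if $\mu(A)=\sup\{\mu(K):K\subset A,\ K \text{ compact}\}$ for every Borel set $A\subset Y$. The weak-star semicontinuity topology on the finite Borel measures on $Y$ is the smallest topology for which $\mu\mapsto\int_Y f\,d\mu$ is upper semicontinuous for every bounded upper semicontinuous $f:Y\to\mathbb{R}$; convergence of nets in it is written $\mu_\alpha\stackrel{wsc*}{\rightharpoonup}\mu$. For $\mathcal{U}\subset\mathcal{X}$, a Borel probability measure $\rho$ on $\mathcal{X}$ is a $\mathcal{U}$-trajectory statistical solution if (i) $\rho$ is tight, and (ii) $\rho$ is carried by a Borel subset of $\mathcal{X}$ included in $\mathcal{U}$, i.e. there is a Borel set $\mathcal{V}\subset\mathcal{U}$ with $\rho(\mathcal{X}\setminus\mathcal{V})=0$. A measure $\rho$ is carried by a Borel set $\mathcal{V}$ if $\rho(\mathcal{X}\setminus\mathcal{V})=0$. For a net $\{A_\gamma\}_{\gamma\in\Gamma}$ of subsets of a topological space, indexed by a directed set $(\Gamma,\preccurlyeq)$, the topological superior limit is $\limsup_\gamma A_\gamma=\bigcap_{\gamma\in\Gamma}\overline{\bigcup_{\gamma\preccurlyeq\beta}A_\beta}$.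 *)

(* Defs.v *)
From HB Require Import structures.
From mathcomp Require Export all_boot all_order all_algebra.
From mathcomp Require Import finmap.
From mathcomp Require Export all_classical all_reals all_analysis.

Set Implicit Arguments.
Unset Strict Implicit.
Unset Printing Implicit Defensive.

Import Order.TTheory GRing.Theory Num.Theory.
Import numFieldNormedType.Exports.

Local Open Scope classical_set_scope.
Local Open Scope ring_scope.

Record directed_set (E : Type) (le : E -> E -> Prop) : Prop := DirectedSet {
  directed_nonempty : inhabited E ;
  directed_refl : forall e, le e e ;
  directed_trans : forall e1 e2 e3, le e1 e2 -> le e2 e3 -> le e1 e3 ;
  directed_ub : forall e1 e2, exists e, le e1 e /\ le e2 e }.

(** A net [u] indexed by [(E, le)] converges to [l] when
    [u @ net_tails le --> l]. *)
Definition net_tails (E : Type) (le : E -> E -> Prop) : set_system E :=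
  filter_from [set: E] (fun g => [set b | le g b]).

Lemma net_tails_proper (E : Type) (le : E -> E -> Prop) :
  directed_set le -> ProperFilter (net_tails le).
Proof.
move=> [[e0] lexx letr ledir]; apply: filter_from_proper; last first.
  by move=> e _; exists e; exact: lexx.
apply: filter_from_filter; first by exists e0.
move=> a b _ _; have [c [ac bc]] := ledir a b.
by exists c => // d /= cd; split; [exact: letr cd|exact: letr cd].
Qed.

(** Willard subnets: the reindexing map is monotone and cofinal. *)
Definition subnet_map (E : Type) (leE : E -> E -> Prop)
    (D : Type) (leD : D -> D -> Prop) (h : D -> E) : Prop :=
  (forall d1 d2, leD d1 d2 -> leE (h d1) (h d2)) /\
  (forall e, exists d, leE e (h d)).

Definition top_limsup (T : topologicalType) (E : Type) (le : E -> E -> Prop)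
    (A : E -> set T) : set T :=
  \bigcap_(g in [set: E]) closure (\bigcup_(b in [set b | le g b]) A b).

Definition borel (Y : ptopologicalType) : measurableType (sigma_display _) :=
  g_sigma_algebraType (@open Y).

(** Dual of the library's [lower_semicontinuous]. *)
Definition upper_semicontinuous (Y : topologicalType) (R : numFieldType)
    (f : Y -> \bar R) : Prop :=
  forall y (a : R), (f y < a%:E)%E ->
    exists2 V, nbhs y V & forall z, V z -> (f z < a%:E)%E.

Definition bounded_usc (Y : topologicalType) (R : realType) (f : Y -> R) : Prop :=
  upper_semicontinuous (EFin \o f) /\ [bounded f y | y in [set: Y]].

Definition fin_borel_measure (R : realType) (Y : ptopologicalType) : Type :=
  {finite_measure set (borel Y) -> \bar R}.

Section weak_star_semicontinuity_topology.
Context (R : realType) (Y : ptopologicalType).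
Local Notation M := (fin_borel_measure R Y).

Definition borel_int (f : Y -> R) (mu : M) : \bar R :=
  (\int[(mu : {finite_measure set (borel Y) -> \bar R})]_y (f y)%:E)%E.

(** A topology makes [borel_int f] upper semicontinuous iff all the sets
    [borel_int f < c] are open, hence the following subbase. *)
Definition wsc_subbase : set (set M) :=
  [set B | exists f (c : R), bounded_usc f /\
    B = [set mu | (borel_int f mu < c%:E)%E]].

HB.instance Definition _ := gen_eqMixin M.
HB.instance Definition _ := gen_choiceMixin M.
HB.instance Definition _ := isSubBaseTopological.Build M wsc_subbase id.

Lemma wsc_subbase_open (B : set M) : wsc_subbase B -> open B.
Proof.
move=> sB; exists [set B]; last by rewrite bigcup_set1.
by move=> _ ->; exact: (@finI_from1 _ _ wsc_subbase id).
Qed.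

Lemma borel_int_usc (f : Y -> R) :
  bounded_usc f -> upper_semicontinuous (borel_int f).
Proof.
move=> bf mu a fa; exists [set nu | (borel_int f nu < a%:E)%E] => //.
by apply: open_nbhs_nbhs; split => //; apply: wsc_subbase_open; exists f, a.
Qed.

(** The topology above is the smallest one satisfying [borel_int_usc]: take for
    [g] the identity from any other such topology. *)
Lemma wsc_smallest (T : topologicalType) (g : T -> M) :
  (forall f, bounded_usc f -> upper_semicontinuous (borel_int f \o g)) ->
  continuous g.
Proof.
move=> gP t B; rewrite nbhsE /= => -[_ [[F FO <-] [A FA At]] OB].
have [S SF SA] : finI_from wsc_subbase id A by exact: FO.
suff: nbhs t (g @^-1` A).
  by apply: filterS => x Ax; apply: OB; exists A.
have : nbhs t (\bigcap_(C in [set` S]) (g @^-1` C)); last first.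
  by apply: filterS => x xS; rewrite -SA => C CS; exact: (xS _ CS).
apply: filter_bigI => C CS.
have [f [c [bf CE]]] : wsc_subbase C by have := SF _ CS; rewrite inE.
have fc : (borel_int f (g t) < c%:E)%E.
  have : C (g t) by move: At; rewrite -SA; apply.
  by rewrite CE.
have [V tV VP] := gP f bf t c fc.
by rewrite CE; apply: filterS tV => x /VP.
Qed.

End weak_star_semicontinuity_topology.

Definition fin_of_prob (R : realType) (Y : ptopologicalType)
    (P : probability (borel Y) R) : fin_borel_measure R Y :=
  (P : {finite_measure set (borel Y) -> \bar R}).

Definition tight (R : realType) (Y : ptopologicalType)
    (mu : fin_borel_measure R Y) : Prop :=
  let m := mu : {finite_measure set (borel Y) -> \bar R} in
  forall A : set (borel Y), measurable A ->
    m A = ereal_sup [set m K | K in [set K : set Y | K `<=` A /\ compact K]].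

Definition carried_by (R : realType) (Y : ptopologicalType)
    (P : probability (borel Y) R) (V : set (borel Y)) : Prop :=
  measurable V /\ P (~` V) = 0%E.

(** Continuous functions on [I], with the compact-open topology; [I] is
    coerced to the subtype [set_type I], whose topology is induced by [R]. *)
Definition Cloc (R : realType) (I : set R) (X : ptopologicalType) : Type :=
  continuousType I X.

Section Cloc.
Context (R : realType) (I : set R) (X : ptopologicalType).

Definition Cloc_fun (u : Cloc I X) : {compact-open, I -> X} :=
  (u : continuousType I X) : I -> X.

HB.instance Definition _ := Choice.copy (Cloc I X) (continuousType I X).
HB.instance Definition _ :=
  Topological.copy (Cloc I X) (initial_topology Cloc_fun).

HB.instance Definition _ := isPointed.Build (Cloc I X) (cst point : continuousType I X).

Definition Pi (t : I) (u : borel (Cloc I X)) : borel X := Cloc_fun u t.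

Lemma Pi_continuous (t : I) : continuous (Pi t : Cloc I X -> X).
Proof.
move=> u B; rewrite nbhsE /= => -[W [oW Wu]] WB.
apply: (@filterS _ _ _ (Pi t @^-1` W)); first by move=> v /WB.
apply: open_nbhs_nbhs; split => //.
exists [set g : {compact-open, I -> X} | g @` [set t] `<=` W].
  by apply: compact_open_open => //; exact: compact_set1.
apply/seteqP; split => v /=; last by move=> Wv _ [_ -> <-].
by apply; exists t.
Qed.

Lemma measurable_Pi (t : I) : measurable_fun [set: borel (Cloc I X)] (Pi t).
Proof.
apply: (@measurability _ _ (borel (Cloc I X)) (borel X) _ _ (@open X)) => // _ [W oW <-].
rewrite setTI; apply: sub_sigma_algebra.
by move/continuousP : (@Pi_continuous t); apply.
Qed.

HB.instance Definition _ (t : I) :=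
  isMeasurableFun.Build _ _ _ _ (Pi t) (measurable_Pi t).

Definition trajectory_statistical_solution (U : set (Cloc I X))
    (P : probability (borel (Cloc I X)) R) : Prop :=
  tight (fin_of_prob P) /\ exists2 V, V `<=` U & carried_by P V.

(** [distribution P f] is the library's push-forward of a probability. *)
Definition Pi_push (t : I) (P : probability (borel (Cloc I X)) R) :
    probability (borel X) R :=
  distribution P (Pi t : {mfun borel (Cloc I X) >-> borel X}).

End Cloc.

Definition closed_left_endpoint (R : realType) (I : set R) (t0 : I) : Prop :=
  forall t, I t -> \val t0 <= t.

(* Main.v *)
From HB Require Import structures.
From mathcomp Require Import finmap.
Require Import Defs.
From mathcomp Require Import lra measurable_realfun.

Set Implicit Arguments.
Unset Strict Implicit.
Unset Printing Implicit Defensive.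

Import Order.TTheory GRing.Theory Num.Theory.
Import numFieldNormedType.Exports.

Local Open Scope classical_set_scope.
Local Open Scope ring_scope.

(** The net is refined to an ultrafilter [G] on its index set, along which every
    net in a compact space converges. The set function
    [nu A = lim rho_e A] along [G] is then a finitely additive probability which
    by (A1) leaves mass at most [delta n] outside [K n], but it need not be
    countably additive. A Riesz-type construction ([tight_below_content]) turns
    it into a tight probability [rho] with [rho O <= nu O] for all open [O],
    that is [nu F <= rho F] for all closed [F].

    Convergence in the weak-star semicontinuity topology amounts to the
    condition [limsup rho_e F <= rho F] on closed sets ([wsc_cvg_closed] and
    [wsc_cvg_of_closed]), because the integral of a bounded upper semicontinuous
    function is, by layer cake, uniformly approximated by positive combinations
    of measures of its closed superlevel sets. So [rho] is the limit along [G],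
    and [filter_subnet] replaces [G] by a subnet.

    The measures give the closure of a tail of the sets [V_ e `&` K n] mass at
    least [1 - delta n] eventually, so [rho] does as well. The intersection of
    these closures is the superior limit; as the decreasing family of
    closed sets eventually leaves any compact set that avoids this intersection,
    tightness yields mass at least [1 - delta n] for the superior limit too
    ([top_limsup_mass]). By (A2) the union over [n] of these closed sets is a
    Borel subset of [U] that carries [rho].

    Finally the projection at [t0] is continuous, so the projections of [rho_e]
    converge along [G] to the projection of [rho], which is tight; they also
    converge to [mu0], and two tight limits coincide
    ([tight_wsc_limit_unique]). *)

(** * Compact sets in Hausdorff spaces *)

(** Compactness read on filters: if no single set of [F] had a closure missing
    [C], the traces of these closures on [C] would generate a proper filter,
    and its cluster point in [C] would be a cluster point of [F]. Applied to
    neighbourhood filters it separates compact sets; applied to the tails of a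
    net of sets, whose cluster set is the topological superior limit, it
    gives the escape property used in [top_limsup_mass]. *)
Lemma compact_avoids_cluster (T : topologicalType) (F : set_system T)
    (C : set T) : Filter F -> compact C -> C `&` cluster F = set0 ->
  exists2 V, F V & C `&` closure V = set0.
Proof.
move=> FF cC CF0; apply: contrapT => noV.
have GF : ProperFilter (filter_from F (fun V => C `&` closure V)).
  apply: filter_from_proper.
    apply: filter_from_filter; first by exists setT; exact: filterT.
    move=> A B FA FB; exists (A `&` B); first exact: filterI.
    by move=> x [Cx /closureI[Ax Bx]].
  by move=> V FV; apply/set0P/eqP => V0; apply: noV; exists V.
have [|x [Cx xG]] := cC _ GF.
  by exists setT => [|x []]; first exact: filterT.
have : (C `&` cluster F) x.
  split=> // A B FA; rewrite nbhsE => -[B' [oB' B'x] B'B].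
  have [y [[_ Ay] B'y]] : (C `&` closure A) `&` B' !=set0.
    by apply: xG; [exists A|exact: open_nbhs_nbhs].
  have [z [Az B'z]] := Ay B' (open_nbhs_nbhs (conj oB' B'y)).
  by exists z; split=> //; exact: B'B.
by rewrite CF0.
Qed.

(** Two uses of [compact_avoids_cluster]: with [nbhs x], whose only cluster
    point is [x], every [x] in [C] gets a neighbourhood whose closure misses
    [D]; hence [C] misses the cluster set of the filter [set_nbhs D]. *)
Lemma compact_separation (T : topologicalType) (C D : set T) :
  hausdorff_space T -> compact C -> compact D -> C `&` D = set0 ->
  exists P Q, [/\ open P, open Q, C `<=` P, D `<=` Q & P `&` Q = set0].
Proof.
move=> hT cC cD CD0.
have [|W WD CW] := @compact_avoids_cluster _ (set_nbhs D) C _ cC.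
  apply/seteqP; split=> // x [Cx xD].
  have [|V xV DV] := @compact_avoids_cluster _ (nbhs x) D _ cD.
    apply/seteqP; split=> // y [Dy /hT xy].
    by rewrite -CD0; split=> //; rewrite -xy.
  have [|z [nVz Vz]] := xD (~` closure V) V _ xV.
    apply/set_nbhsP; exists (~` closure V); split => //.
      exact/closed_openC/closed_closure.
    by move=> y Dy Vy; rewrite -[False]/(set0 y) -DV.
  exact: nVz (subset_closure Vz).
have [Q [oQ DQ QW]] := (set_nbhsP _ _).1 WD.
exists (~` closure W), Q; split=> //.
- exact/closed_openC/closed_closure.
- by move=> x Cx Wx; rewrite -[False]/(set0 x) -CW.
- by apply/seteqP; split=> // x [nWx /QW/subset_closure].
Qed.

(** The disjoint compact sets [C `\` O1] and [C `\` O2] have disjoint open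
    neighbourhoods [P] and [Q]; removing these from [C] gives the pieces. *)
Lemma compact_split_open (T : topologicalType) (C O1 O2 : set T) :
  hausdorff_space T -> compact C -> open O1 -> open O2 -> C `<=` O1 `|` O2 ->
  exists C1 C2, [/\ compact C1 /\ C1 `<=` O1, compact C2 /\ C2 `<=` O2 &
    C = C1 `|` C2].
Proof.
move=> hT cC o1 o2 CO.
have [|||P [Q [oP oQ CP CQ PQ]]] :=
  @compact_separation _ (C `\` O1) (C `\` O2) hT.
- by apply: compact_closedI => //; exact: open_closedC.
- by apply: compact_closedI => //; exact: open_closedC.
- by apply/seteqP; split=> // x [[/CO[]]] // ? ? [].
exists (C `\` P), (C `\` Q); split.
- split; first by apply: compact_closedI => //; exact: open_closedC.
  by move=> x [Cx nPx]; apply: contrapT => n1; apply/nPx/CP.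
- split; first by apply: compact_closedI => //; exact: open_closedC.
  by move=> x [Cx nPx]; apply: contrapT => n1; apply/nPx/CQ.
- by rewrite -setDIr PQ setD0.
Qed.

(** * Borel sets and tightness *)

Lemma open_borel (Y : ptopologicalType) (A : set Y) :
  open A -> measurable (A : set (borel Y)).
Proof. exact: sub_sigma_algebra. Qed.

Lemma closed_borel (Y : ptopologicalType) (A : set Y) :
  closed A -> measurable (A : set (borel Y)).
Proof.
by move=> /closed_openC/open_borel/measurableC; rewrite setCK.
Qed.

Lemma compact_borel (Y : ptopologicalType) (A : set Y) :
  hausdorff_space Y -> compact A -> measurable (A : set (borel Y)).
Proof. by move=> hY cA; apply: closed_borel; exact: compact_closed. Qed.

(** Compact sets are Borel in a Hausdorff space, so only the inequality
    [mu A <= sup] in the definition of tightness has content. *)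
Lemma tight_of_approx (R : realType) (Y : ptopologicalType)
    (mu : fin_borel_measure R Y) : hausdorff_space Y ->
  (forall (A : set (borel Y)) (e : R), measurable A -> 0 < e ->
    exists C : set Y, [/\ compact C, C `<=` A &
      ((mu : {finite_measure set (borel Y) -> \bar R}) A <=
       (mu : {finite_measure set (borel Y) -> \bar R}) C + e%:E)%E]) ->
  tight mu.
Proof.
move=> hY approx; rewrite /tight /= => A mA; apply/eqP.
rewrite eq_le; apply/andP; split.
  apply/lee_addgt0Pr => e e0; have [C [cC CA AC]] := approx A e mA e0.
  apply: (le_trans AC); rewrite leeD2r//.
  by apply: ereal_sup_ubound; exists C.
apply: ge_ereal_sup => _ [C [CA cC] <-].
by apply: le_measure; rewrite ?inE//; exact: compact_borel.
Qed.

Lemma cvg0_small (R : realType) (delta : nat -> R) (e : R) :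
  delta @ \oo --> (0 : R) -> 0 < e -> exists n, delta n < e.
Proof.
move=> delta0 e0; have [N _ /(_ N (leqnn N)) ?] := cvgr_lt _ delta0 _ e0.
by exists N.
Qed.

(** * A tight probability below a finitely additive one *)

(** A limit of probabilities along an ultrafilter is only finitely additive.
    From such a [nu] three set functions are derived in turn, on compact, open
    and arbitrary sets. Taking the infimum over open neighbourhoods and then
    the supremum over compact subsets discards the part of [nu] that is not
    carried by compact sets; covering directly by countably many open
    sets would keep it, and open sets would then fail to be
    Caratheodory measurable in general. *)
Section radon_of_content.
Local Open Scope ereal_scope.
Context (R : realType) (Y : ptopologicalType).
Hypothesis hY : hausdorff_space Y.
Variable nu : {content set (borel Y) -> \bar R}.
Hypothesis nuT : nu [set: borel Y] = 1.

Definition outer_compact (C : set Y) : \bar R :=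
  ereal_inf [set nu G | G in [set G : set Y | open G /\ C `<=` G]].

Definition inner_open (G : set Y) : \bar R :=
  ereal_sup [set outer_compact C | C in [set C | compact C /\ C `<=` G]].

Definition radon_outer (A : set Y) : \bar R :=
  ereal_inf [set inner_open G | G in [set G : set Y | open G /\ A `<=` G]].

Local Notation lam := outer_compact.
Local Notation h := inner_open.
Local Notation m := radon_outer.

Lemma content_open_le (A B : set Y) :
  open A -> open B -> A `<=` B -> nu A <= nu B.
Proof.
by move=> oA oB AB; apply: le_measure => //; rewrite inE; exact: open_borel.
Qed.

Lemma outer_compact_ge0 C : 0 <= lam C.
Proof. by apply: le_ereal_inf_tmp => _ [G _ <-]; exact: measure_ge0. Qed.

Lemma outer_compact_le_content C G : open G -> C `<=` G -> lam C <= nu G.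
Proof. by move=> oG CO; apply: ereal_inf_lbound; exists G. Qed.

Lemma outer_compact_le1 C : lam C <= 1.
Proof.
by rewrite -nuT; apply: outer_compact_le_content => //; exact: openT.
Qed.

Lemma outer_compact_fin_num C : lam C \is a fin_num.
Proof.
rewrite ge0_fin_numE ?outer_compact_ge0//.
by rewrite (le_lt_trans (outer_compact_le1 _))// ltry.
Qed.

Lemma outer_compact0 : lam set0 = 0.
Proof.
apply/eqP; rewrite eq_le outer_compact_ge0 andbT -(measure0 nu).
by apply: outer_compact_le_content => //; exact: open0.
Qed.

Lemma outer_compactU C D : lam (C `|` D) <= lam C + lam D.
Proof.
rewrite -leeBlDr ?outer_compact_fin_num//.
apply: le_ereal_inf_tmp => _ [G [oG CO] <-].
rewrite leeBlDr ?outer_compact_fin_num// addeC -leeBlDr.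
  apply: le_ereal_inf_tmp => _ [H [oH DH] <-].
  rewrite leeBlDr.
    apply: (@le_trans _ _ (nu (H `|` G))).
      rewrite setUC; apply: outer_compact_le_content; first exact: openU.
      exact: setUSS.
    by apply: measureU2; exact: open_borel.
  rewrite ge0_fin_numE ?measure_ge0//.
  by rewrite (@le_lt_trans _ _ 1) ?ltry// -nuT content_open_le//; exact: openT.
rewrite ge0_fin_numE ?measure_ge0//.
by rewrite (@le_lt_trans _ _ 1) ?ltry// -nuT content_open_le//; exact: openT.
Qed.

(** Disjoint compact sets have disjoint open neighbourhoods, on which the
    finite additivity of [nu] applies. *)
Lemma outer_compact_superadditive C D :
  compact C -> compact D -> C `&` D = set0 ->
  lam C + lam D <= lam (C `|` D).
Proof.
move=> cC cD CD0; apply: le_ereal_inf_tmp => _ [G [oG CDO] <-].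
have [P [Q [oP oQ CP DQ PQ]]] := compact_separation hY cC cD CD0.
have oOP : open (G `&` P) by exact: openI.
have oOQ : open (G `&` Q) by exact: openI.
apply: (@le_trans _ _ (nu (G `&` P) + nu (G `&` Q))).
  apply: leeD; apply: outer_compact_le_content => // x Cx; split.
  - by apply: CDO; left.
  - exact: CP.
  - by apply: CDO; right.
  - exact: DQ.
rewrite -measureU; [|exact: open_borel|exact: open_borel|];
  last by rewrite setIACA PQ setI0.
by apply: content_open_le => //; [exact: openU|move=> x [] []].
Qed.

Lemma inner_open_ge0 G : 0 <= h G.
Proof.
rewrite -outer_compact0; apply: ereal_sup_ubound; exists set0 => //; split=> //.
exact: compact0.
Qed.

Lemma outer_compact_le_inner C G : compact C -> C `<=` G -> lam C <= h G.
Proof. by move=> cC CO; apply: ereal_sup_ubound; exists C. Qed.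

Lemma inner_open_le_content G : open G -> h G <= nu G.
Proof.
move=> oG; apply: ge_ereal_sup => _ [C [cC CO] <-].
exact: outer_compact_le_content.
Qed.

Lemma le_inner_open G H : G `<=` H -> h G <= h H.
Proof.
move=> GH; apply: ge_ereal_sup => _ [C [cC CO] <-].
apply: outer_compact_le_inner => //.
exact: subset_trans GH.
Qed.

Lemma inner_open_le1 G : h G <= 1.
Proof.
by apply: ge_ereal_sup => _ [C [cC CO] <-]; exact: outer_compact_le1.
Qed.

(** A compact subset of the union is the union of compact subsets of each
    part. *)
Lemma inner_openU G H : open G -> open H -> h (G `|` H) <= h G + h H.
Proof.
move=> oG oH; apply: ge_ereal_sup => _ [C [cC CO] <-].
have [C1 [C2 [[c1 s1] [c2 s2] ->]]] := compact_split_open hY cC oG oH CO.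
apply: (le_trans (outer_compactU _ _)).
by apply: leeD; exact: outer_compact_le_inner.
Qed.

(** Compactness turns a countable cover of [C] into a finite one: this is the
    only source of countable additivity in the construction. *)
Lemma inner_open_sigma_subadditive (G : nat -> set Y) :
  (forall i, open (G i)) ->
  h (\bigcup_i G i) <= \sum_(i <oo) h (G i).
Proof.
move=> oG; apply: ge_ereal_sup => _ [C [cC CO] <-].
have [n Cn] : exists n, C `<=` \big[setU/set0]_(i < n) G i.
  have /compact_near_coveringP := cC.
  move=> /(_ nat \oo (fun n x => (\big[setU/set0]_(i < n) G i) x)).
  case=> [x /CO[k _ Okx]|k _ /(_ k (leqnn _)) ?]; last by exists k.
  exists (G k, [set n | (k < n)%N]) => /=.
    split; first exact/open_nbhs_nbhs.
    by exists k.+1.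
  by move=> [y n] /= [Oky kn]; rewrite -bigcup_mkord; exists k.
apply: (@le_trans _ _ (\sum_(0 <= i < n) h (G i))); last first.
  by apply: nneseries_lim_ge => *; exact: inner_open_ge0.
rewrite big_mkord (le_trans (outer_compact_le_inner cC Cn))//.
have : open (\big[setU/set0]_(i < n) G i) /\
  h (\big[setU/set0]_(i < n) G i) <= \sum_(i < n) h (G i); last by case.
elim: n {Cn} => [|n [on IH]].
  rewrite !big_ord0; split; first exact: open0.
  apply: ge_ereal_sup => _ [D [_] +] <-.
  by rewrite subset0 => ->; rewrite outer_compact0.
rewrite !big_ord_recr/=; split; first exact: openU.
by apply: (le_trans (inner_openU _ _)) => //; exact: leeD2r.
Qed.

Lemma radon_outer_ge0 A : 0 <= m A.
Proof. by apply: le_ereal_inf_tmp => _ [G _ <-]; exact: inner_open_ge0. Qed.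

Lemma radon_outer_le_inner A G : open G -> A `<=` G -> m A <= h G.
Proof. by move=> oG AO; apply: ereal_inf_lbound; exists G. Qed.

Lemma radon_outer_fin_num A : m A \is a fin_num.
Proof.
rewrite ge0_fin_numE ?radon_outer_ge0//; apply: (@le_lt_trans _ _ (h setT)).
  by apply: radon_outer_le_inner => //; exact: openT.
by rewrite (le_lt_trans (inner_open_le1 _))// ltry.
Qed.

Lemma radon_outer_open G : open G -> m G = h G.
Proof.
move=> oG; apply/eqP; rewrite eq_le radon_outer_le_inner//=.
by apply: le_ereal_inf_tmp => _ [H [_ GH] <-]; exact: le_inner_open.
Qed.

Lemma radon_outer_compact C : compact C -> m C = lam C.
Proof.
move=> cC; apply/eqP; rewrite eq_le; apply/andP; split.
  apply: le_ereal_inf_tmp => _ [G [oG CO] <-].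
  apply: (le_trans (radon_outer_le_inner oG CO)).
  exact: inner_open_le_content.
by apply: le_ereal_inf_tmp => _ [G [oG CO] <-]; exact: outer_compact_le_inner.
Qed.

Lemma le_radon_outer : {homo m : A B / A `<=` B >-> A <= B}.
Proof.
move=> A B AB; apply: le_ereal_inf_tmp => _ [G [oG BO] <-].
by apply: radon_outer_le_inner => //; exact: subset_trans BO.
Qed.

Lemma radon_outer0 : m set0 = 0.
Proof.
by rewrite radon_outer_compact ?outer_compact0//; exact: compact0.
Qed.

Lemma radon_outer_sigma_subadditive : sigma_subadditive m.
Proof.
move=> A; apply/lee_addgt0Pr => e e0.
have /choice[V OP] : forall n, exists G, [/\ open G, A n `<=` G &
    h G <= m (A n) + (e / (2 ^ n.+1)%:R)%:E].
  move=> n; have en : (0 < e / (2 ^ n.+1)%:R)%R.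
    by rewrite divr_gt0// ltr0n expn_gt0.
  have [_ [G [oG AO] <-] /ltW hO] :=
    lb_ereal_inf_adherent en (radon_outer_fin_num (A n)).
  by exists G.
apply: (le_trans _ (epsilon_trick _ _ (ltW e0))); last first.
  by move=> n; exact: radon_outer_ge0.
apply: (@le_trans _ _ (\sum_(i <oo) h (V i))); last first.
  apply: lee_nneseries => [i _ _|i _]; first exact: inner_open_ge0.
  by have [] := OP i.
have oV i : open (V i) by have [] := OP i.
apply: le_trans (inner_open_sigma_subadditive oV).
apply: radon_outer_le_inner; first exact: bigcup_open.
by move=> x [i _ Aix]; exists i => //; have [_ + _] := OP i; apply.
Qed.

HB.instance Definition _ :=
  isOuterMeasure.Build R Y m radon_outer0 radon_outer_ge0 le_radon_outer
    radon_outer_sigma_subadditive.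

(** Given an open [W], exhaust [W `&` G] by a compact [C], then the open set
    [W `\` C], which contains [W `\` G], by a compact [D]. As [C] and [D] are
    disjoint compact subsets of [W], superadditivity bounds the sum of their
    values by the value of [W]. *)
Lemma radon_caratheodory_open G : open G -> m.-caratheodory G.
Proof.
move=> oG; apply: le_caratheodory_measurable => X.
apply: le_ereal_inf_tmp => _ [W [oW XW] <-].
have oWO : open (W `&` G) by exact: openI.
apply: (@le_trans _ _ (m (W `&` G) + m (W `&` ~` G))).
  by apply: leeD; apply: le_radon_outer; exact: setSI.
rewrite radon_outer_open// -leeBrDr ?radon_outer_fin_num//.
apply: ge_ereal_sup => _ [C [cC CGO] <-].
rewrite leeBrDr ?radon_outer_fin_num//.
have oWC : open (W `\` C).
  by apply: openI => //; apply: closed_openC; exact: compact_closed.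
apply: (@le_trans _ _ (lam C + h (W `\` C))).
  rewrite leeD2l//; apply: radon_outer_le_inner => // x [Gx nOx]; split=> // Cx.
  by apply: nOx; have [] := CGO _ Cx.
rewrite addeC -leeBrDr ?outer_compact_fin_num//.
apply: ge_ereal_sup => _ [D [cD DG] <-].
rewrite leeBrDr ?outer_compact_fin_num//.
apply: (@le_trans _ _ (lam (D `|` C))).
  apply: outer_compact_superadditive => //.
  apply/seteqP; split=> // x [/DG[_ nC] Cx].
  exact: nC.
apply: outer_compact_le_inner; first exact: compactU.
by move=> x [/DG[]//|/CGO[]].
Qed.

Lemma radon_caratheodory_borel (A : set (borel Y)) :
  measurable A -> m.-caratheodory A.
Proof.
suff : <<s @open Y >> `<=` m.-cara.-measurable by apply.
apply: smallest_sub; last by move=> G; exact: radon_caratheodory_open.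
split=> [|B mB|F mF].
- exact: caratheodory_measurable_set0.
- by rewrite setTD; exact: caratheodory_measurable_setC.
- exact: caratheodory_measurable_bigcup.
Qed.

Definition radon : set (borel Y) -> \bar R := m.

Lemma radon_sigma_additive : semi_sigma_additive radon.
Proof.
move=> F mF tF mUF; apply: (@caratheodory_measure_sigma_additive R Y m) => //.
- by move=> i; exact: (radon_caratheodory_borel (mF i)).
- exact: radon_caratheodory_borel mUF.
Qed.

HB.instance Definition _ := isMeasure.Build _ _ _ radon
  radon_outer0 radon_outer_ge0 radon_sigma_additive.

Variables (K : nat -> set Y) (delta : nat -> R).
Hypotheses (cK : forall n, compact (K n)) (delta0 : delta @ \oo --> (0 : R)%R).
Hypothesis nuK : forall n, nu (~` K n) <= (delta n)%:E.

Lemma radon_outer_compact_compl n : m (~` K n) <= (delta n)%:E.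
Proof.
have oK : open (~` K n) by apply: closed_openC; exact: compact_closed.
by rewrite radon_outer_open// (le_trans (inner_open_le_content oK)).
Qed.

Lemma radon_setT : radon setT = 1.
Proof.
apply/eqP; rewrite eq_le; apply/andP; split.
  by rewrite /radon radon_outer_open; [exact: inner_open_le1|exact: openT].
apply/lee_addgt0Pr => e e0; have [n ne] := cvg0_small delta0 e0.
rewrite -leeBlDr//.
apply: (@le_trans _ _ (lam (K n))); last first.
  by rewrite -radon_outer_compact//; exact: le_radon_outer.
apply: le_ereal_inf_tmp => _ [G [oG KG] <-].
rewrite leeBlDr// (@le_trans _ _ (nu G + nu (~` K n)))//; last first.
  by rewrite leeD2l// (le_trans (nuK n))// lee_fin ltW.
have oK : open (~` K n) by apply: closed_openC; exact: compact_closed.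
rewrite -nuT (_ : setT = G `|` ~` K n).
  by apply: measureU2; exact: open_borel.
apply/seteqP; split=> // x _; have [/KG|] := pselect (K n x); first by left.
by right.
Qed.

HB.instance Definition _ :=
  Measure_isProbability.Build _ _ R radon radon_setT.

(** Outer regularity of [m] at [~` A] gives a closed subset of [A] that
    exhausts [A] up to [e / 2]; intersecting with [K n] makes it compact at
    the cost of another [e / 2]. *)
Lemma radon_tight : tight (fin_of_prob radon).
Proof.
apply: tight_of_approx => // A e mA e0.
have e2 : (0 < e / 2)%R by rewrite divr_gt0.
have [n ne] := cvg0_small delta0 e2.
have [_ [G [oG AG] <-] /ltW hG] :=
  lb_ereal_inf_adherent e2 (radon_outer_fin_num (~` A)).
exists (K n `&` ~` G); split.
- by apply: compact_closedI => //; exact: open_closedC.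
- by move=> x [_ nGx]; apply: contrapT => /AG.
rewrite /=.
have mGA : m (G `&` A) <= (e / 2)%:E.
  have := radon_caratheodory_borel mA G; rewrite radon_outer_open// => hGE.
  rewrite -(@leeD2rE _ (m (~` A)) _ _ (radon_outer_fin_num _)) [leRHS]addeC.
  apply: le_trans hG; rewrite -/(h G) hGE leeD2l//; apply: le_radon_outer.
  by move=> x nAx; split=> //; exact: AG.
apply: (@le_trans _ _ (m ((K n `&` ~` G) `|` ((G `&` A) `|` ~` K n)))).
  apply: le_radon_outer => x Ax.
  have [Kx|] := pselect (K n x); last by right; right.
  by have [Gx|] := pselect (G x); [right; left|left].
apply: (le_trans (outer_measureU2 m _ _)); rewrite leeD2l//.
apply: (le_trans (outer_measureU2 m _ _)).
rewrite [in leRHS](splitr e) EFinD; apply: leeD => //.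
by apply: (le_trans (radon_outer_compact_compl n)); rewrite lee_fin ltW.
Qed.

(** The total mass survives because [nu] is almost carried by the [K n]. *)
Lemma tight_below_content : exists P : probability (borel Y) R,
  tight (fin_of_prob P) /\ forall G : set Y, open G -> P G <= nu G.
Proof.
exists radon; split; first exact: radon_tight.
move=> G oG; rewrite /= /radon radon_outer_open//.
exact: inner_open_le_content.
Qed.

End radon_of_content.

(** * Limits along ultrafilters *)

Lemma ultra_cvg_compact (T : topologicalType) (E : Type) (G : set_system E)
    (f : E -> T) (C : set T) : UltraFilter G -> compact C ->
  (\forall e \near G, C (f e)) -> exists2 l, C l & f @ G --> l.
Proof.
move=> UG cC GC.
have [l [Cl fl]] := cC (f @ G) _ GC; exists l => // B lB.
have [//|GnB] := in_ultra_setVsetC (f @^-1` B) UG.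
by have [y [nBy By]] : ~` B `&` B !=set0 by exact: fl GnB lB.
Qed.

Section ultralimit_content.
Local Open Scope ereal_scope.
Context d (T : measurableType d) (R : realType) (E : Type) (G : set_system E).
Hypothesis UG : UltraFilter G.
Variable mu_ : E -> probability T R.

Definition ultralimit (A : set T) : \bar R := lim (mu_ e A @[e --> G]).

(** The values lie in the compact interval [[0, 1]]. *)
Lemma ultralimit_cvg (A : set T) : measurable A ->
  mu_ e A @[e --> G] --> ultralimit A.
Proof.
move=> mA.
have [|l _ fl] := ultra_cvg_compact (f := fun e => fine (mu_ e A)) UG
    (@segment_compact R 0%R 1%R).
  apply: nearW => e; rewrite /= in_itv/=; apply/andP; split.
    exact: fine_ge0.
  by rewrite -lee_fin fineK ?fin_num_measure// probability_le1.
suff : mu_ e A @[e --> G] --> l%:E by move=> /cvgP.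
have : ((fine (mu_ e A))%:E @[e --> G]) --> l%:E.
  by apply: cvg_EFin => //; exact: nearW.
by under eq_fun do rewrite fineK ?fin_num_measure//.
Qed.

(** A content must be nonnegative on all sets. Off the measurable sets the
    limit may fail to exist, and then [lim] is the default point [0]. *)
Lemma ultralimit_ge0 A : 0 <= ultralimit A.
Proof.
have [cA|ncA] := pselect (cvg (mu_ e A @[e --> G])).
  by apply: lime_ge => //; exact: nearW.
by rewrite /ultralimit dvgP.
Qed.

Lemma ultralimit_semi_additive : measure_function.semi_additive ultralimit.
Proof.
move=> F n mF tF mUF; apply: cvg_lim => //.
under eq_fun do rewrite measure_semi_additive//.
apply: cvg_nnesum => i _; last exact: ultralimit_cvg.
exact: nearW.
Qed.

HB.instance Definition _ := isContent.Build _ T R ultralimit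
  ultralimit_ge0 ultralimit_semi_additive.

Lemma ultralimit_setT : ultralimit setT = 1.
Proof.
rewrite /ultralimit; under eq_fun do rewrite probability_setT.
exact: lim_cst.
Qed.

Lemma ultralimit_content : exists nu : {content set T -> \bar R},
  nu setT = 1 /\ forall A, measurable A -> mu_ e A @[e --> G] --> nu A.
Proof.
by exists ultralimit; split; [exact: ultralimit_setT|exact: ultralimit_cvg].
Qed.

End ultralimit_content.

(** * Weak-star semicontinuity convergence tested on closed sets *)

Section portmanteau.
Context (R : realType) (Y : ptopologicalType) (E : Type) (F : set_system E).
Context {FF : Filter F}.
Variables (mu_ : E -> probability (borel Y) R) (mu : probability (borel Y) R).

(** Indicators of closed sets are the test functions that bring the topology
    back to values of measures on sets. *)
Lemma usc_indic (A : set Y) : closed A -> bounded_usc (\1_A : Y -> R).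
Proof.
move=> cA; split=> [y a /=|].
  have [Ay|nAy] := pselect (A y) => ya.
    exists setT; first exact: filterT.
    move=> z _; apply: le_lt_trans ya.
    by rewrite lee_fin !indicE (mem_set Ay) ler_nat leq_b1.
  exists (~` A).
    by apply: open_nbhs_nbhs; split => //; exact: closed_openC.
  by move=> z nAz; move: ya; rewrite !indicE !memNset.
exists 1; split=> // M M1 y _ /=; apply: le_trans (ltW M1).
by rewrite indicE ger0_norm ?ler0n// lern1 leq_b1.
Qed.

Lemma borel_int_indic (nu : probability (borel Y) R) (A : set Y) : closed A ->
  borel_int (\1_A) (fin_of_prob nu) = nu A.
Proof.
move=> cA; rewrite /borel_int integral_indic ?setIT//.
exact: (@closed_borel Y).
Qed.

Lemma wsc_cvg_closed :
  (fun e => fin_of_prob (mu_ e)) @ F --> fin_of_prob mu ->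
  forall (A : set Y) (c : R), closed A -> (mu A < c%:E)%E ->
    \forall e \near F, (mu_ e A < c%:E)%E.
Proof.
move=> cvmu A c cA muA.
have /cvmu : nbhs (fin_of_prob mu)
    [set nu : fin_borel_measure R Y | (borel_int \1_A nu < c%:E)%E].
  apply: open_nbhs_nbhs; split.
    apply: wsc_subbase_open; exists \1_A, c; split => //.
    exact: usc_indic.
  by rewrite /= borel_int_indic.
rewrite nbhs_simpl /=; apply: filterS => e /=.
by rewrite borel_int_indic.
Qed.

(** A neighbourhood contains a finite intersection of subbasic sets. *)
Lemma wsc_cvg_subbase :
  (forall (f : Y -> R) (c : R), bounded_usc f ->
    (borel_int f (fin_of_prob mu) < c%:E)%E ->
    \forall e \near F, (borel_int f (fin_of_prob (mu_ e)) < c%:E)%E) ->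
  (fun e => fin_of_prob (mu_ e)) @ F --> fin_of_prob mu.
Proof.
move=> fP B; rewrite nbhsE /= => -[_ [[D DF <-] [A DA Amu]] DB].
have [S SF SA] : finI_from (@wsc_subbase R Y) id A by exact: DF.
suff : F ((fun e => fin_of_prob (mu_ e)) @^-1` A).
  by apply: filterS => x Ax; apply: DB; exists A.
have : F (\bigcap_(C in [set` S]) ((fun e => fin_of_prob (mu_ e)) @^-1` C)).
  apply: filter_bigI => C CS.
  have [f [c [bf CE]]] : wsc_subbase C by have := SF _ CS; rewrite inE.
  rewrite CE; apply: fP => //.
  have : C (fin_of_prob mu) by move: Amu; rewrite -SA; apply.
  by rewrite CE.
by apply: filterS => x xS; rewrite -SA => C CS; exact: (xS _ CS).
Qed.

End portmanteau.

(** The sum is [w] times the number of levels [w *+ k], [k < N], that are at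
    most [t]; there are [floor (t / w) + 1] of them, or [N] if [t] is [w *+ N]. *)
Lemma staircase_bounds (R : realType) (w t : R) (N : nat) :
  0 <= w -> 0 <= t -> t <= w *+ N ->
  t <= \sum_(k < N) w * (w *+ k <= t)%R%:R <= t + w.
Proof.
move=> w0 t0 tN; apply/andP; split.
  elim: N tN => [|N IH] tN; first by rewrite big_ord0 -(mulr0n w).
  rewrite big_ord_recr/=; have [Nt|tN'] := leP (w *+ N) t; last first.
    by rewrite mulr0 addr0 IH// ltW.
  rewrite (eq_bigr (fun=> w)) => [|k _].
    by rewrite sumr_const card_ord mulr1 -mulrSr.
  by rewrite (le_trans _ Nt) ?mulr1// ler_wpMn2l// ltnW.
elim: N {tN} => [|N IH]; first by rewrite big_ord0 addr_ge0.
rewrite big_ord_recr/=; have [Nt|tN'] := leP (w *+ N) t; last first.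
  by rewrite mulr0 addr0.
rewrite mulr1 lerD2r (le_trans _ Nt)// -[N in leRHS]card_ord -sumr_const.
by apply: ler_sum => k _; rewrite ler_piMr// lern1 leq_b1.
Qed.

Lemma usc_superlevel_closed (R : realType) (Y : ptopologicalType) (f : Y -> R)
    (a : R) : bounded_usc f -> closed [set y | a <= f y].
Proof.
move=> [fusc _]; rewrite (_ : [set y | a <= f y] = ~` [set y | f y < a]).
  apply: open_closedC; rewrite openE => y /= fya.
  have [|V yV Va] := fusc y a; first by rewrite lte_fin.
  by apply: filterS yV => z /Va; rewrite /= lte_fin.
by apply/seteqP; split => y /=; rewrite leNgt => /negP.
Qed.

Lemma bounded_usc_measurable (R : realType) (Y : ptopologicalType)
    (f : Y -> R) :
  bounded_usc f -> measurable_fun [set: borel Y] (f : borel Y -> R).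
Proof.
move=> bf; apply: (measurability _ (RGenCInfty.measurableE R)).
move=> /= _ [_ [a ->] <-]; rewrite setTI; apply: closed_borel.
rewrite (_ : f @^-1` _ = [set y | a <= f y]).
  exact: usc_superlevel_closed.
by apply/seteqP; split=> y /=; rewrite in_itv/= andbT.
Qed.

Lemma bounded_usc_integrable (R : realType) (Y : ptopologicalType) (f : Y -> R)
    (Q : probability (borel Y) R) :
  bounded_usc f -> Q.-integrable [set: borel Y] (EFin \o f).
Proof.
move=> bf; apply: measurable_bounded_integrable => //.
- by rewrite -ge0_fin_numE// fin_num_measure.
- exact: bounded_usc_measurable.
- exact: bf.2.
Qed.

(** Shifted to be nonnegative, [f] is within [w] of the staircase built on its
    superlevel sets, which are closed. So, uniformly in [Q], its integral is
    within [e] of a positive combination of measures of closed sets. *)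
Lemma usc_layer_cake (R : realType) (Y : ptopologicalType) (f : Y -> R)
    (e : R) : bounded_usc f -> 0 < e ->
  exists (b w : R) (N : nat) (F : nat -> set Y),
    [/\ 0 < w, forall k, closed (F k) &
    forall Q : probability (borel Y) R,
    (borel_int f (fin_of_prob Q) <= b%:E + \sum_(k < N) w%:E * Q (F k) <=
     borel_int f (fin_of_prob Q) + e%:E)%E].
Proof.
move=> bf e0; have [M0 [_ M0f]] := bf.2.
pose M := `|M0| + 1.
have M_gt0 : 0 < M by rewrite ltr_pwDr.
have fM y : `|f y| <= M by apply: M0f => //; rewrite ltr_pwDr// ler_norm.
(* [N] steps of height [w] span the range [-M, M] of [f]; [N] is large enough
   for [w <= e]. *)
pose N := (Num.truncn (M *+ 2 / e)).+1.
pose w := M *+ 2 / N%:R.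
have w0 : 0 < w by rewrite divr_gt0// ?pmulrn_lgt0.
have we : w <= e.
  rewrite /w ler_pdivrMr ?ltr0n// mulrC -ler_pdivrMr//.
  by apply: ltW; rewrite /N truncnS_gt.
pose g y := f y + M.
have g0 y : 0 <= g y.
  by rewrite /g -lerBlDr sub0r; have := fM y; rewrite ler_norml => /andP[].
have gN y : g y <= w *+ N.
  rewrite -mulr_natr divfK ?pnatr_eq0// /g mulr2n lerD2r.
  by have := fM y; rewrite ler_norml => /andP[].
pose F k := [set y | w *+ k - M <= f y].
have cF k : closed (F k) by exact: usc_superlevel_closed.
have mF k : measurable (F k : set (borel Y)) by exact: closed_borel.
have mI k : measurable_fun [set: borel Y] (\1_(F k) : borel Y -> R).
  exact: (@measurable_indic _ (borel Y)).
have indF k y : (w *+ k <= g y)%R%:R = \1_(F k) y :> R.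
  by rewrite indicE; congr (nat_of_bool _)%:R; apply/idP/idP;
    rewrite inE /F /g /= lerBlDr.
exists (- M), w, N, F; split=> // Q.
have intf : Q.-integrable [set: borel Y] (EFin \o f).
  exact: bounded_usc_integrable.
have intc (c : R) : Q.-integrable [set: borel Y] (EFin \o cst c).
  by apply: finite_measure_integrable_cst.
have intfc (c : R) :
    (\int[Q]_y (f y + c)%:E = borel_int f (fin_of_prob Q) + c%:E)%E.
  rewrite /borel_int (_ : c%:E = \int[Q]_y (c%:E))%E; last first.
    by rewrite integral_cst// [X in (_ * X)%E](probability_setT Q) mule1.
  by rewrite -(integralD_EFin _ intf (intc c)).
have ints : (\int[Q]_y (\sum_(k < N) w * \1_(F k) y)%:E
    = \sum_(k < N) w%:E * Q (F k))%E.
  under eq_integral do rewrite -sumEFin.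
  rewrite ge0_integral_sum//=.
  - apply: eq_bigr => k _; under eq_integral do rewrite EFinM.
    rewrite ge0_integralZl_EFin//; last exact: ltW.
    + by rewrite integral_indic// setIT.
    + by apply/measurable_EFinP; exact: mI.
  - move=> k; apply/measurable_EFinP; exact: measurable_funM.
  - by move=> k y _; rewrite lee_fin mulr_ge0// ltW.
have ms : measurable_fun [set: borel Y]
    (fun y => (\sum_(k < N) w * \1_(F k) y)%:E).
  apply/measurable_EFinP; apply: measurable_sum => k; exact: measurable_funM.
have mg c : measurable_fun [set: borel Y] (fun y : borel Y => (f y + c)%:E).
  apply/measurable_EFinP; apply: measurable_funD => //.
  exact: bounded_usc_measurable.
have stair y := staircase_bounds (ltW w0) (g0 y) (gN y).
rewrite -ints; apply/andP; split.
  rewrite EFinN addeC leeBrDr// -intfc; apply: ge0_le_integral => //.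
  - by move=> y _; rewrite lee_fin; exact: g0.
  - move=> y _; rewrite lee_fin; have /andP[+ _] := stair y.
    by under eq_bigr do rewrite indF.
apply: (@le_trans _ _ (borel_int f (fin_of_prob Q) + w%:E)%E); last first.
  by rewrite leeD2l// lee_fin.
rewrite EFinN addeC leeBlDr// -addeA -EFinD -intfc.
apply: ge0_le_integral => //.
- by move=> y _; rewrite lee_fin sumr_ge0// => k _; rewrite mulr_ge0// ltW.
- move=> y _; rewrite lee_fin; have /andP[_] := stair y.
  by under eq_bigr do rewrite indF; rewrite /g -addrA [M + w]addrC.
Qed.

(** The converse of [wsc_cvg_closed]: in the finite sum of
    [usc_layer_cake] each term is upper semicontinuous along [F]. *)
Lemma wsc_cvg_of_closed (R : realType) (Y : ptopologicalType) (E : Type)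
    (F : set_system E) (mu_ : E -> probability (borel Y) R)
    (mu : probability (borel Y) R) : Filter F ->
  (forall (A : set Y) (c : R), closed A -> (mu A < c%:E)%E ->
    \forall e \near F, (mu_ e A < c%:E)%E) ->
  (fun e => fin_of_prob (mu_ e)) @ F --> fin_of_prob mu.
Proof.
move=> FF closedP; apply: wsc_cvg_subbase => f c bf fc.
set r := fine (borel_int f (fin_of_prob mu)).
have rE : borel_int f (fin_of_prob mu) = r%:E.
  by rewrite fineK//; exact: integrable_fin_num (bounded_usc_integrable mu bf).
move: fc; rewrite rE lte_fin => rc.
(* One [d] pays for the layer cake of [mu], another for replacing [mu] by
   [mu_ e] in its [N] terms; a third keeps the inequality strict. *)
pose d := (c - r) / 3.
have d0 : 0 < d by rewrite divr_gt0// subr_gt0.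
have [b [w [N [A [w0 cA AP]]]]] := usc_layer_cake bf d0.
pose eta := d / (w * N.+1%:R).
have eta0 : 0 < eta by rewrite divr_gt0// mulr_gt0.
have Afin (Q : probability (borel Y) R) k : Q (A k) = (fine (Q (A k)))%:E.
  by rewrite fineK// fin_num_measure//; exact: closed_borel.
have : \forall e \near F, forall k : 'I_N,
    (mu_ e (A k) < (fine (mu (A k)) + eta)%:E)%E.
  apply: filter_forall => k; apply: closedP => //.
  by rewrite [ltLHS]Afin lte_fin ltrDl.
apply: filterS => e eA.
have /andP[+ _] := AP (mu_ e); move=> /le_lt_trans; apply.
have /andP[_] := AP mu; rewrite rE.
under eq_bigr do rewrite Afin -EFinM.
under [in X in _ -> X]eq_bigr do rewrite Afin -EFinM.
rewrite !sumEFin -!EFinD lee_fin lte_fin => bs.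
apply: (@le_lt_trans _ _ (b + \sum_(k < N) w * fine (mu (A k)) + d)).
  rewrite -addrA lerD2l.
  apply: (@le_trans _ _ (\sum_(k < N) (w * fine (mu (A k)) + w * eta))).
    apply: ler_sum => k _; rewrite -mulrDr ler_wpM2l ?ltW// -lte_fin -Afin.
    exact: eA.
  rewrite big_split/= lerD2l sumr_const card_ord.
  rewrite /eta invfM mulrCA mulVKf ?gt_eqF//.
  rewrite -[leLHS]mulr_natr -mulrA ler_piMr ?ltW// mulrC ltr_pdivrMr ?ltr0n//.
  by rewrite mul1r ltr_nat.
rewrite (le_lt_trans (_ : _ <= r + d + d))// ?lerD2r//.
by rewrite /d; lra.
Qed.

(** * Compactness and uniqueness of tight limits *)

(** The Prokhorov-Topsoe compactness theorem, for ultrafilters: the tight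
    probability below the ultralimit [nu] on open sets is, by complement,
    above [nu] on closed sets, which is convergence. *)
Lemma uniformly_tight_ultra_cvg (R : realType) (Y : ptopologicalType)
    (E : Type) (G : set_system E) (mu_ : E -> probability (borel Y) R)
    (K : nat -> set Y) (delta : nat -> R) :
  hausdorff_space Y -> UltraFilter G -> (forall n, compact (K n)) ->
  delta @ \oo --> (0 : R) -> (forall n e, (mu_ e (~` K n) <= (delta n)%:E)%E) ->
  exists P : probability (borel Y) R, tight (fin_of_prob P) /\
    (fun e => fin_of_prob (mu_ e)) @ G --> fin_of_prob P.
Proof.
move=> hY UG cK delta0 muK; have [nu [nuT nuP]] := ultralimit_content UG mu_.
have mKC n : measurable (~` K n : set (borel Y)).
  by apply: measurableC; exact: compact_borel.
have nuK n : (nu (~` K n) <= (delta n)%:E)%E.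
  by apply: cvge_le (nuP _ (mKC n)); exact: nearW.
have [P [tP Pnu]] := tight_below_content hY nuT cK delta0 nuK.
exists P; split=> //; apply: wsc_cvg_of_closed => A c cA PA.
have mA : measurable (A : set (borel Y)) by exact: closed_borel.
have nuA : (nu A <= P A)%E.
  have := Pnu _ (closed_openC cA); rewrite probability_setC//.
  have : (nu A + nu (~` A) = 1)%E.
    by rewrite -measureU ?setICr ?setUCr ?nuT//; exact: measurableC.
  have := measure_ge0 nu A; have := measure_ge0 nu (~` A).
  rewrite -[P A]fineK ?fin_num_measure//.
  case: (nu A) (nu (~` A)) => [a| |] [b| |]//=.
  by rewrite -!EFinD => _ _ [] ab; rewrite !lee_fin; lra.
suff : nbhs (nu A) [set x | (x < c%:E)%E] by move/(nuP _ mA).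
have := le_lt_trans nuA PA; have := measure_ge0 nu A.
case: (nu A) => [a| |]//= _; rewrite lte_fin => ac.
exact: (@nbhs_open_ereal_lt _ _ (fun=> c)).
Qed.

Lemma tight_inner_approx (R : realType) (Y : ptopologicalType)
    (P : probability (borel Y) R) (A : set (borel Y)) (e : R) :
  tight (fin_of_prob P) -> measurable A -> 0 < e ->
  exists C : set Y, [/\ compact C, C `<=` A & (P A <= P C + e%:E)%E].
Proof.
move=> tP mA e0; have PA : P A = ereal_sup
    [set P C | C in [set C : set Y | C `<=` A /\ compact C]] by exact: tP.
have := @ub_ereal_sup_adherent _
  [set P C | C in [set C : set Y | C `<=` A /\ compact C]] _ e0.
rewrite -PA fin_num_measure// => /(_ isT)[_ [C [CA cC] <-]].
rewrite lteBlDr// => /ltW ?; by exists C.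
Qed.

Lemma tight_distribution (R : realType) (Y Z : ptopologicalType)
    (P : probability (borel Y) R) (f : {mfun borel Y >-> borel Z}) :
  hausdorff_space Y -> hausdorff_space Z -> continuous (f : Y -> Z) ->
  tight (fin_of_prob P) -> tight (fin_of_prob (distribution P f)).
Proof.
move=> hY hZ cf tP; apply: tight_of_approx => // A e mA e0.
have mfA : measurable (f @^-1` A).
  by rewrite -[_ @^-1` _]setTI; exact: measurable_funP.
have [C [cC CA PA]] := tight_inner_approx tP mfA e0.
have cfC : compact ((f : Y -> Z) @` C).
  by apply: continuous_compact => //; exact: continuous_subspaceT.
exists (f @` C); split=> //; first by move=> _ [y Cy <-]; exact: CA.
apply: (le_trans PA); rewrite leeD2r//; apply: le_measure.
- by rewrite inE; exact: compact_borel.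
- rewrite inE -[_ @^-1` _]setTI; apply: measurable_funP => //.
  exact: compact_borel.
- by move=> y Cy; exists y.
Qed.

Lemma distribution_wsc_cvg (R : realType) (Y Z : ptopologicalType) (E : Type)
    (F : set_system E) (mu_ : E -> probability (borel Y) R)
    (mu : probability (borel Y) R) (f : {mfun borel Y >-> borel Z}) :
  Filter F -> continuous (f : Y -> Z) ->
  (fun e => fin_of_prob (mu_ e)) @ F --> fin_of_prob mu ->
  (fun e => fin_of_prob (distribution (mu_ e) f)) @ F -->
    fin_of_prob (distribution mu f).
Proof.
move=> FF cf cvmu; apply: wsc_cvg_of_closed => A c cA.
apply: (@wsc_cvg_closed _ _ _ _ _ _ _ cvmu (f @^-1` A) c).
by move/continuous_closedP : cf; apply.
Qed.

(** The topology need not be Hausdorff on all measures, but tight limits are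
    unique. If closed sets [A] and [B] cover the space then [mu_ e A] and
    [mu_ e B] sum to at least [1], and so do [mu A] and [nu B], which bound
    their superior limits. Taking for [A] and [B] the complements of disjoint
    open sets that separate a compact [C] from a compact set exhausting [~` C]
    gives [mu C <= nu C]; tightness and complements do the rest. *)
Lemma tight_wsc_limit_unique (R : realType) (Y : ptopologicalType) (E : Type)
    (F : set_system E) (mu_ : E -> probability (borel Y) R)
    (mu nu : probability (borel Y) R) :
  hausdorff_space Y -> ProperFilter F ->
  tight (fin_of_prob mu) -> tight (fin_of_prob nu) ->
  (fun e => fin_of_prob (mu_ e)) @ F --> fin_of_prob mu ->
  (fun e => fin_of_prob (mu_ e)) @ F --> fin_of_prob nu ->
  forall A : set (borel Y), measurable A -> mu A = nu A.
Proof.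
move=> hY FF tmu tnu cvmu cvnu.
pose p (Q : probability (borel Y) R) (A : set (borel Y)) := fine (Q A).
have pE (Q : probability (borel Y) R) (A : set (borel Y)) :
    measurable A -> Q A = (p Q A)%:E.
  by move=> mA; rewrite fineK// fin_num_measure.
have pC (Q : probability (borel Y) R) (A : set (borel Y)) :
    measurable A -> p Q (~` A) = 1 - p Q A.
  move=> mA; have := probability_setC Q mA.
  by rewrite !pE//; [rewrite -EFinB => -[]|exact: measurableC].
have pM (Q : probability (borel Y) R) (A B : set (borel Y)) :
    measurable A -> measurable B -> A `<=` B -> p Q A <= p Q B.
  by move=> mA mB AB; rewrite -lee_fin -!pE// le_measure ?inE.
have cover (A B : set Y) : closed A -> closed B -> A `|` B = setT ->
    1 <= p mu A + p nu B.
  move=> cA cB AB; have mA := closed_borel cA; have mB := closed_borel cB.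
  apply/ler_addgt0Pr => e e0.
  have muA : (mu A < (p mu A + e / 2)%:E)%E.
    by rewrite pE// lte_fin ltrDl divr_gt0.
  have nuB : (nu B < (p nu B + e / 2)%:E)%E.
    by rewrite pE// lte_fin ltrDl divr_gt0.
  have [x [xA xB]] := filter_ex (filterI (wsc_cvg_closed cvmu cA muA)
    (wsc_cvg_closed cvnu cB nuB)).
  have : (mu_ x (A `|` B) <= mu_ x A + mu_ x B)%E by exact: measureU2.
  move: xA xB; rewrite AB probability_setT !pE// -EFinD !lte_fin lee_fin.
  lra.
have le_C (C : set Y) : compact C -> p mu C <= p nu C.
  move=> cC; have mC := compact_borel hY cC; apply/ler_addgt0Pr => e e0.
  have [D [cD DC nuD]] := tight_inner_approx tnu (measurableC mC) e0.
  have mD := compact_borel hY cD.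
  have [|P [Q [oP oQ CP DQ PQ]]] := compact_separation hY cC cD.
    by apply/seteqP; split=> // x [Cx /DC].
  have mP := open_borel oP; have mQ := open_borel oQ.
  have := cover (~` P) (~` Q) (open_closedC oP) (open_closedC oQ).
  rewrite -setCI PQ setC0 => /(_ erefl).
  move: nuD; rewrite pE; last exact: measurableC.
  rewrite [X in (_ <= X + _)%E -> _]pE// -EFinD lee_fin !pC//.
  have := pM mu _ _ mC mP CP; have := pM nu _ _ mD mQ DQ; lra.
have le_A A : measurable A -> p mu A <= p nu A.
  move=> mA; apply/ler_addgt0Pr => e e0.
  have [C [cC CA]] := tight_inner_approx tmu mA e0.
  have mC := compact_borel hY cC.
  rewrite !pE// -EFinD lee_fin.
  by have := le_C _ cC; have := pM nu _ _ mC mA CA; lra.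
move=> A mA; rewrite !pE//; congr EFin; apply/eqP; rewrite eq_le le_A//=.
by have := le_A _ (measurableC mA); rewrite !pC//; lra.
Qed.

(** * Subnets *)

(** The usual subnet attached to a filter finer than the tails: its indices are
    the sets of [G] pointed at one of their elements. Comparing the points as
    well makes the projection monotone. *)
Lemma filter_subnet (E : Type) (le : E -> E -> Prop) (G : set_system E) :
  directed_set le -> ProperFilter G -> net_tails le `<=` G ->
  exists (D : Type) (leD : D -> D -> Prop) (h : D -> E),
    [/\ directed_set leD, subnet_map le leD h & G `<=` h @ net_tails leD].
Proof.
move=> [[e0] lexx letr ledir] PG leG.
have Gtail e : G [set b | le e b] by apply: leG; exists e.
pose D := {x : E * set E | G x.2 /\ x.2 x.1}.
pose h (d : D) := (sval d).1.
pose leD (d d' : D) := le (h d) (h d') /\ (sval d').2 `<=` (sval d).2.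
(* Every set of [G] meets every tail, since both belong to [G]. *)
have DP e S : G S -> exists d : D, le e (h d) /\ (sval d).2 = S.
  move=> GS; have [b [Sb eb]] := filter_ex (filterI GS (Gtail e)).
  by exists (exist _ (b, S) (conj GS Sb)).
exists D, leD, h; split.
- split.
  + by have [d _] := DP e0 setT filterT; exists.
  + by move=> d; split.
  + by move=> d1 d2 d3 [l12 s12] [l23 s23]; split;
      [exact: letr l23|exact: subset_trans s12].
  + move=> d1 d2; have [e [e1 e2]] := ledir (h d1) (h d2).
    have [d [ed dS]] := DP e _ (filterI (svalP d1).1 (svalP d2).1).
    by exists d; split; split; rewrite ?dS; [exact: letr ed|move=> ? []|
      exact: letr ed|move=> ? []].
- split; first by move=> d1 d2 [].
  by move=> e; have [d [ed _]] := DP e setT filterT; exists d.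
- move=> S GS; have [d [_ dS]] := DP e0 S GS.
  exists d => // d' [_]; rewrite dS; apply; exact: (svalP d').2.
Qed.

(** * Mass of the superior limit *)

Lemma top_limsup_measurable (Y : ptopologicalType) (E : Type)
    (le : E -> E -> Prop) (A : E -> set Y) :
  measurable (top_limsup le A : set (borel Y)).
Proof.
apply: closed_borel; apply: closed_bigI => g _; exact: closed_closure.
Qed.

(** By tightness of [P] a compact [C] disjoint from the superior limit carries
    almost all of the complement. The superior limit is the cluster set of the
    filter of tails, so [C] already misses the closure of one tail
    [U g]; along [G] the measures give this closed set mass at least
    [1 - d], and therefore so does [P]. *)
Lemma top_limsup_mass (R : realType) (Y : ptopologicalType) (E : Type)
    (le : E -> E -> Prop) (G : set_system E)
    (mu_ : E -> probability (borel Y) R) (P : probability (borel Y) R)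
    (A : E -> set Y) (d : R) :
  hausdorff_space Y -> directed_set le -> ProperFilter G ->
  net_tails le `<=` G -> tight (fin_of_prob P) ->
  (fun e => fin_of_prob (mu_ e)) @ G --> fin_of_prob P ->
  (forall e, measurable (A e : set (borel Y))) ->
  (forall e, (mu_ e (~` A e) <= d%:E)%E) ->
  (P (~` top_limsup le A) <= d%:E)%E.
Proof.
move=> hY hE PG leG tP cvP mA Ad; set L := top_limsup le A.
have mL : measurable (L : set (borel Y)) by exact: top_limsup_measurable.
apply/lee_addgt0Pr => e e0.
have [C [cC CL PC]] := tight_inner_approx tP (measurableC mL) e0.
apply: (le_trans PC); rewrite leeD2r//.
pose U g := \bigcup_(b in [set b | le g b]) A b.
have [[x0] lexx letr ledir] := hE.
have FU : Filter (filter_from [set: E] U).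
  apply: filter_from_filter; first by exists x0.
  move=> a b _ _; have [c [ac bc]] := ledir a b.
  by exists c => // y [z cz Az]; split; exists z => //=; exact: letr cz.
have [|V [g _ gV] CV] := compact_avoids_cluster FU cC.
  apply/seteqP; split=> // y [/CL nLy Uy]; apply: nLy => g _ B yB.
  by apply: Uy => //; exists g.
have cUg : closed (closure (U g)) by exact: closed_closure.
have mUg := closed_borel cUg.
have CU : C `<=` ~` closure (U g).
  by move=> y Cy /(closureS gV) Vy; rewrite -[False]/(set0 y) -CV.
apply: (@le_trans _ _ (P (~` closure (U g)))).
  apply: le_measure; rewrite ?inE//; first exact: compact_borel.
  exact: measurableC.
rewrite probability_setC// -[P _]fineK ?fin_num_measure// -EFinB lee_fin.
rewrite lerBlDr -lerBlDl; apply: contrapT => /negP; rewrite -ltNge => PU.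
have PUg : (P (closure (U g)) < (1 - d)%:E)%E.
  by rewrite -[ltLHS]fineK ?fin_num_measure// lte_fin.
have Gg : G [set b | le g b] by apply: leG; exists g.
have [b [gb]] := filter_ex (filterI Gg (wsc_cvg_closed cvP cUg PUg)).
rewrite /= ltNge => /negP; apply.
apply: (@le_trans _ _ (mu_ b (A b))); last first.
  apply: le_measure; rewrite ?inE//; apply: subset_trans (@subset_closure _ _).
  by move=> y Ay; exists b.
have := Ad b; rewrite probability_setC// -[mu_ b _]fineK ?fin_num_measure//.
by rewrite -EFinB !lee_fin; lra.
Qed.

(** * Trajectory statistical solutions *)

Lemma Cloc_hausdorff (R : realType) (I : set R) (X : ptopologicalType) :
  hausdorff_space X -> hausdorff_space (Cloc I X).
Proof.
move=> hX u v uv; apply/continuousEP => t; apply: hX => A B uA vB.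
have [w [Aw Bw]] := uv _ _ (@Pi_continuous R I X t u A uA)
  (@Pi_continuous R I X t v B vB).
by exists (Cloc_fun w t).
Qed.

Theorem theorem3p1 (R : realType) (I : set R) (X : ptopologicalType)
    (hI : is_interval I) (hX : hausdorff_space X)
    (E : Type) (le : E -> E -> Prop) (hE : directed_set le)
    (rho_ : E -> probability (borel (Cloc I X)) R)
    (U_ V_ : E -> set (Cloc I X))
    (hrho : forall e, trajectory_statistical_solution (U_ e) (rho_ e))
    (hV : forall e, carried_by (rho_ e) (V_ e))
    (U : set (Cloc I X))
    (K : nat -> set (Cloc I X)) (hK : forall n, compact (K n))
    (delta : nat -> R) (hdelta : delta @ \oo --> (0 : R))
    (A1 : forall n e, (rho_ e (~` K n) < (delta n)%:E)%E)
    (A2 : forall n, top_limsup le (fun e => V_ e `&` K n) `<=` U) :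
  exists rho : probability (borel (Cloc I X)) R,
    [/\ trajectory_statistical_solution U rho,
      exists (D : Type) (leD : D -> D -> Prop) (h : D -> E),
        [/\ directed_set leD, subnet_map le leD h &
          (fun d => fin_of_prob (rho_ (h d))) @ net_tails leD
            --> fin_of_prob rho] &
      forall (t0 : I) (mu0 : probability (borel X) R),
        closed_left_endpoint t0 ->
        tight (fin_of_prob mu0) ->
        (fun e => fin_of_prob (Pi_push t0 (rho_ e))) @ net_tails le
          --> fin_of_prob mu0 ->
        forall A : set (borel X), measurable A -> Pi_push t0 rho A = mu0 A].
Proof.
have hY : hausdorff_space (Cloc I X) by exact: Cloc_hausdorff.
(* A universal subnet, in the guise of an ultrafilter finer than the tails. *)
have [G [UG leG]] := ultraFilterLemma (net_tails_proper hE).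
have A1' n e : (rho_ e (~` K n) <= (delta n)%:E)%E by exact: ltW.
have [rho [trho cvrho]] := uniformly_tight_ultra_cvg hY UG hK hdelta A1'.
exists rho; split.
- split=> //; pose L n := top_limsup le (fun e => V_ e `&` K n).
  have mL n : measurable (L n : set (borel (Cloc I X))).
    exact: top_limsup_measurable.
  have mV : measurable (\bigcup_n L n : set (borel (Cloc I X))).
    exact: bigcupT_measurable.
  have mK n : measurable (K n : set (borel (Cloc I X))) by exact: compact_borel.
  have rhoL n : (rho (~` L n) <= (delta n)%:E)%E.
    apply: (top_limsup_mass hY hE _ leG trho cvrho).
      by move=> e; apply: measurableI => //; have [] := hV e.
    move=> e; have [mVe Ve0] := hV e; rewrite setCI.
    apply: (@le_trans _ _ (rho_ e (~` V_ e) + rho_ e (~` K n))%E).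
      by apply: measureU2; exact: measurableC.
    by rewrite Ve0 add0e.
  (* The union misses mass at most [delta n] for every [n], hence none. *)
  exists (\bigcup_n L n); first by move=> u [n _]; exact: A2.
  split=> //; apply/eqP; rewrite eq_le measure_ge0 andbT.
  apply/lee_addgt0Pr => e e0; rewrite add0e.
  have [n ne] := cvg0_small hdelta e0.
  apply: (@le_trans _ _ (rho (~` L n))).
    apply: le_measure; rewrite ?inE; [exact: measurableC|exact: measurableC|].
    by apply: subsetC; exact: bigcup_sup.
  by rewrite (le_trans (rhoL n))// lee_fin ltW.
- have [D [leD [h [dD sh Gh]]]] := filter_subnet hE _ leG.
  exists D, leD, h; split=> // B /cvrho GB; exact: Gh GB.
- move=> t0 mu0 _ tmu0 cvmu0 A mA.
  have cPi := @Pi_continuous R I X t0.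
  have tPi : tight (fin_of_prob (Pi_push t0 rho)) by exact: tight_distribution.
  have cvPi : (fun e => fin_of_prob (Pi_push t0 (rho_ e))) @ G -->
    fin_of_prob (Pi_push t0 rho) by exact: distribution_wsc_cvg cPi cvrho.
  apply: (tight_wsc_limit_unique hX _ tPi tmu0 cvPi _ mA).
  by move=> B /cvmu0 /leG.
Qed.
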